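(* For all integers $M,N\ge 1$ and every real $M\times N$ matrix $A$, the set $$\mathrm{Bad}_A(M,N)=\Big\{\mathbf{x}\in\mathbb{R}^M:\ \inf_{\mathbf{q}\in\mathbb{Z}^N\setminus\{0\}}\|\mathbf{q}\|^{N/M}\,\mathrm{dist}(A\mathbf{q}-\mathbf{x},\mathbb{Z}^M)>0\Big\}$$ is hyperplane absolute winning (HAW) in $\mathbb{R}^M$.
   Context: $\|\cdot\|$ is the Euclidean norm and $\mathrm{dist}$ the associated distance. Hyperplane absolute winning (HAW). Let $S\subseteq\mathbb{R}^d$ and $0<\beta<1/3$. In the hyperplane $\beta$-absolute game with target set $S$, Bob first chooses a closed ball $B_1\subseteq\mathbb{R}^d$. For each $i\ge1$, once $B_i$ is chosen, Alice chooses an affine hyperplane $\mathcal{L}_i\subseteq\mathbb{R}^d$ and a number $0<\varepsilon_i\le\beta\rho(B_i)$, where $\rho(B)$ denotes the radius of $B$. Bob must then choose a closed ball $B_{i+1}\subseteq B_i$ with $\rho(B_{i+1})\ge\beta\rho(B_i)$ and $B_{i+1}\cap\mathcal{L}_i^{(\varepsilon_i)}=\varnothing$, where $\mathcal{L}^{(\varepsilon)}=\{\mathbf{z}:\mathrm{dist}(\mathbf{z},\mathcal{L})\le\varepsilon\}$ is the $\varepsilon$-thickening of $\mathcal{L}$. Alice wins if and only if $S\cap\bigcap_i B_i\ne\varnothing$. The set $S$ is hyperplane $\beta$-absolute winning if Alice has a winning strategy in this game, and $S$ is hyperplane absolute winning (HAW) if there exists $\beta_0\in(0,1/3]$ such that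 $S$ is hyperplane $\beta$-absolute winning for all $0<\beta<\beta_0$. *)

(* Defs.v *)
From HB Require Import structures.
From mathcomp Require Import all_boot all_order all_algebra.
From mathcomp Require Import all_classical all_reals all_analysis.

Set Implicit Arguments.
Unset Strict Implicit.
Unset Printing Implicit Defensive.

Import Order.TTheory GRing.Theory Num.Theory.

Local Open Scope classical_set_scope.
Local Open Scope ring_scope.

(* The norm that MathComp-Analysis puts on matrices is the sup norm, hence the
   explicit Euclidean norm. *)
Definition dotv (R : realType) (d : nat) (u v : 'cV[R]_d) : R :=
  \sum_(i < d) u i 0 * v i 0.

Definition enorm (R : realType) (d : nat) (u : 'cV[R]_d) : R :=
  Num.sqrt (dotv u u).

(* [inf] is only meaningful on nonempty sets: [E] is always a hyperplane or the
   integer lattice below. *)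
Definition dist_to (R : realType) (d : nat) (z : 'cV[R]_d) (E : set 'cV[R]_d) : R :=
  inf [set enorm (z - y) | y in E].

Definition Zlattice (R : realType) (d : nat) : set 'cV[R]_d :=
  [set map_mx intr p | p in [set: 'cV[int]_d]].

Definition is_hyperplane (R : realType) (d : nat) (L : set 'cV[R]_d) : Prop :=
  exists (n : 'cV[R]_d) (c : R), n != 0 /\ L = [set z | dotv n z = c].

Definition thickening (R : realType) (d : nat) (L : set 'cV[R]_d) (eps : R) :
    set 'cV[R]_d :=
  [set z | dist_to z L <= eps].

Record eball (R : realType) (d : nat) := EBall {
  ecenter : 'cV[R]_d;
  eradius : R;
  eradius_gt0 : 0 < eradius }.

Definition eball_set (R : realType) (d : nat) (B : eball R d) : set 'cV[R]_d :=
  [set z | enorm (z - ecenter B) <= eradius B].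

Definition alice_move (R : realType) (d : nat) : Type := (set 'cV[R]_d * R)%type.

Definition alice_legal (R : realType) (d : nat) (beta : R) (B : eball R d)
    (m : alice_move R d) : Prop :=
  [/\ is_hyperplane m.1, 0 < m.2 & m.2 <= beta * eradius B].

Definition bob_legal (R : realType) (d : nat) (beta : R) (B : eball R d)
    (m : alice_move R d) (B' : eball R d) : Prop :=
  [/\ eball_set B' `<=` eball_set B,
      beta * eradius B <= eradius B' &
      eball_set B' `&` thickening m.1 m.2 = set0].

(* A strategy for Alice maps the nonempty list of balls chosen so far, oldest
   first, to her next move; her own earlier moves are determined by it. *)
Definition strategy (R : realType) (d : nat) : Type :=
  seq (eball R d) -> alice_move R d.

Definition response (R : realType) (d : nat) (sigma : strategy R d)
    (B : nat -> eball R d) (n : nat) : alice_move R d :=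
  sigma (mkseq B n.+1).

(* Bob's moves B 0, ..., B n are legal when Alice plays sigma; the values of B
   beyond n are irrelevant. *)
Definition legal_upto (R : realType) (d : nat) (beta : R) (sigma : strategy R d)
    (B : nat -> eball R d) (n : nat) : Prop :=
  forall i : nat, (i < n)%N -> bob_legal beta (B i) (response sigma B i) (B i.+1).

(* The first clause says that sigma answers every reachable position by a legal
   move. *)
Definition winning_strategy (R : realType) (d : nat) (beta : R)
    (S : set 'cV[R]_d) (sigma : strategy R d) : Prop :=
  (forall (B : nat -> eball R d) (n : nat),
     legal_upto beta sigma B n -> alice_legal beta (B n) (response sigma B n)) /\
  (forall B : nat -> eball R d,
     (forall n : nat, legal_upto beta sigma B n) ->
     S `&` \bigcap_(i in [set: nat]) eball_set (B i) !=set0).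

Definition hyperplane_absolute_winning_at (R : realType) (d : nat) (beta : R)
    (S : set 'cV[R]_d) : Prop :=
  exists sigma : strategy R d, winning_strategy beta S sigma.

Definition HAW (R : realType) (d : nat) (S : set 'cV[R]_d) : Prop :=
  exists beta0 : R, [/\ 0 < beta0, beta0 <= 3^-1 &
    forall beta : R, 0 < beta -> beta < beta0 ->
      hyperplane_absolute_winning_at beta S].

Definition Bad (R : realType) (M N : nat) (A : 'M[R]_(M, N)) : set 'cV[R]_M :=
  [set x | 0 < inf [set enorm (map_mx intr q : 'cV[R]_N) `^ (N%:R / M%:R) *
                        dist_to (A *m map_mx intr q - x) (@Zlattice R M)
                   | q in [set q : 'cV[int]_N | q != 0]]].

(* Main.v *)
Require Import Defs.
From mathcomp Require Import all_boot all_order all_algebra.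
From mathcomp Require Import all_classical all_reals all_analysis.
From mathcomp Require Import lra ring zify.

Set Implicit Arguments.
Unset Strict Implicit.
Unset Printing Implicit Defensive.

Import Order.TTheory GRing.Theory Num.Theory.

Local Open Scope classical_set_scope.
Local Open Scope ring_scope.

(** The proof has two independent halves.

    Transference.  If an integer vector [y] has [A^T y] close to an integer
    vector, then [y . (A q)] is close to an integer for every [q] of moderate
    size, so any [x] whose [y . x] stays away from the integers is repelled by
    all the points [A q - p]: if [e = A q - x - p], then
    [delta <= dist (y . x, Z) <= |q| dist (A^T y, Z^N) + |y| |e|].
    Dirichlet's theorem supplies, for each scale [j], such a [y] with
    [|y| <= 2^(N j)] and [dist (A^T y, Z^N) <= 2^(-M j)] up to constants, and
    choosing the scale with [2^(M j)] comparable to [|q|] turns the inequality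
    into [|e| >= c |q|^(-N/M)].  Only one vector per block
    [2^(N (i-1)) <= |y| <= 2^(N i)] is needed, the one that makes [A^T y] closest
    to integers, because every Dirichlet vector may be replaced with the best
    vector of its block ([best_in_blocks_error], [transference]).

    The game.  The vectors selected above form a lacunary sequence, and for any
    lacunary sequence [y_i] the set of [x] such that the numbers [y_i . x] keep a
    uniform distance from the integers is absolute winning
    ([lacunary_absolute_winning]).  Consider the integral hyperplanes
    [y_i . x = p] with [|y_i| rho] at most a small constant, [rho] being the
    radius of the current ball; at most one of them per index [i] meets the ball,
    and those that do are called live.  In a ball of radius [rho] such hyperplanes
    are described by [M + 1] parameters in a fixed box, so that up to [beta rho]
    there are only [g + 1] kinds of them, where [g] depends on [beta] and on the dimension
    but not on how many are live.  By removing one hyperplane of the commonest kind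
    Alice kills a proportion [1 / (g + 1)] of the live ones ([killing_move]).
    When nothing is live she removes a hyperplane through the centre, which forces
    the radius to halve ([center_move]).
    The game is cut into phases of [m + 1] turns.  By lacunarity at most [a (m + 1)]
    new hyperplanes come into play at the end of a phase, a number linear in [m],
    whereas [m] turns divide the number of live ones by an exponential in [m]; so
    for large [m] ([shrinking_beats_linear]) every phase disposes of all the
    hyperplanes it started with and still has one turn left to halve the radius.
    Within one phase radii drop by a bounded factor only, which is why the
    neighbourhoods removed have size at least [delta / |y_i|] for a fixed
    [delta]. *)

(** * Euclidean geometry in coordinates *)

Section Euclid.
Variables (R : realType) (d : nat).
Implicit Types (u v w : 'cV[R]_d).

Lemma dotvC u v : dotv u v = dotv v u.
Proof. by apply: eq_bigr => i _; rewrite mulrC. Qed.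

Lemma dotvDr u v w : dotv u (v + w) = dotv u v + dotv u w.
Proof. by rewrite /dotv -big_split; apply: eq_bigr => i _; rewrite mxE mulrDr. Qed.

Lemma dotvZr a u v : dotv u (a *: v) = a * dotv u v.
Proof. by rewrite /dotv mulr_sumr; apply: eq_bigr => i _; rewrite mxE mulrCA. Qed.

Lemma dotvNr u v : dotv u (- v) = - dotv u v.
Proof. by rewrite -scaleN1r dotvZr mulN1r. Qed.

Lemma dotvBr u v w : dotv u (v - w) = dotv u v - dotv u w.
Proof. by rewrite dotvDr dotvNr. Qed.

Lemma dotvZl a u v : dotv (a *: u) v = a * dotv u v.
Proof. by rewrite dotvC dotvZr dotvC. Qed.

Lemma dotvBl u v w : dotv (v - w) u = dotv v u - dotv w u.
Proof. by rewrite dotvC dotvBr !(dotvC u). Qed.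

Lemma dotv_delta u i : dotv (delta_mx i 0) u = u i 0.
Proof.
rewrite /dotv (bigD1 i) //= big1 ?addr0 ?mxE ?eqxx ?mul1r // => j ji.
by rewrite mxE (negPf ji) mul0r.
Qed.

Lemma dotv_ge0 u : 0 <= dotv u u.
Proof. by apply: sumr_ge0 => i _; rewrite -expr2 sqr_ge0. Qed.

Lemma enorm_ge0 u : 0 <= enorm u. Proof. exact: sqrtr_ge0. Qed.

Lemma enorm_sqr u : enorm u ^+ 2 = dotv u u.
Proof. by rewrite sqr_sqrtr // dotv_ge0. Qed.

Lemma enormZ a u : enorm (a *: u) = `|a| * enorm u.
Proof.
by rewrite /enorm dotvZr dotvZl mulrA -expr2 sqrtrM ?sqr_ge0 // sqrtr_sqr.
Qed.

Lemma enorm0 : enorm (0 : 'cV[R]_d) = 0.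
Proof. by rewrite -(scale0r (0 : 'cV[R]_d)) enormZ normr0 mul0r. Qed.

Lemma enorm_delta i : enorm (delta_mx i 0 : 'cV[R]_d) = 1.
Proof. by rewrite /enorm dotv_delta mxE !eqxx sqrtr1. Qed.

Lemma ler_entry_enorm u i : `|u i 0| <= enorm u.
Proof.
rewrite -(@ler_pXn2r _ 2) ?nnegrE ?enorm_ge0 // enorm_sqr real_normK ?num_real //.
rewrite /dotv (bigD1 i) //= expr2 lerDl.
by apply: sumr_ge0 => j _; rewrite -expr2 sqr_ge0.
Qed.

Lemma ler_dotv a t u v : (forall i, `|u i 0| <= a) -> (forall i, `|v i 0| <= t) ->
  `|dotv u v| <= d%:R * (a * t).
Proof.
move=> ua vt; apply: le_trans (ler_norm_sum _ _ _) _.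
apply: (@le_trans _ _ (\sum_(i < d) a * t)); last first.
  by rewrite sumr_const card_ord mulr_natl.
by apply: ler_sum => i _; rewrite normrM ler_pM.
Qed.

(** Cauchy-Schwarz, from the square of [enorm v *: u - enorm u *: v]. *)
Lemma dotv_le_enorm u v : dotv u v <= enorm u * enorm v.
Proof.
have [v0|v0] := eqVneq (enorm v) 0.
  rewrite v0 mulr0 /dotv big1 // => i _.
  have : `|v i 0| <= 0 by rewrite -v0 ler_entry_enorm.
  by rewrite normr_le0 => /eqP ->; rewrite mulr0.
have [u0|u0] := eqVneq (enorm u) 0.
  rewrite u0 mul0r /dotv big1 // => i _.
  have : `|u i 0| <= 0 by rewrite -u0 ler_entry_enorm.
  by rewrite normr_le0 => /eqP ->; rewrite mul0r.
have := dotv_ge0 (enorm v *: u - enorm u *: v).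
rewrite dotvBr !dotvBl !dotvZr !dotvZl -!enorm_sqr (dotvC v u).
have : 0 < enorm u * enorm v by rewrite mulr_gt0 // lt_neqAle eq_sym enorm_ge0 andbT.
move: (enorm u) (enorm v) (dotv u v) => a b c ab h.
rewrite -(ler_pM2l ab); nra.
Qed.

Lemma ler_enormD u v : enorm (u + v) <= enorm u + enorm v.
Proof.
rewrite -(@ler_pXn2r _ 2) ?nnegrE ?enorm_ge0 ?addr_ge0 ?enorm_ge0 //.
rewrite sqrrD !enorm_sqr dotvDr ![dotv (u + v) _]dotvC !dotvDr (dotvC v u).
by have := dotv_le_enorm u v; lra.
Qed.

Lemma enorm_le_bound t u : (forall i, `|u i 0| <= t) -> enorm u <= d%:R * t.
Proof.
move=> ut; have [d0|/lt0n_neq0 d0] := posnP d.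
  suff -> : enorm u = 0 by rewrite d0 mul0r.
  rewrite /enorm /dotv big1 ?sqrtr0 // => i.
  by have := ltn_ord i; rewrite {2}d0.
have d1 : 1 <= d%:R :> R by rewrite ler1n lt0n.
have t0 : 0 <= t.
  by apply: le_trans (normr_ge0 _) (ut (Ordinal (_ : 0 < d)%N)); rewrite lt0n.
rewrite -(@ler_pXn2r _ 2) ?nnegrE ?enorm_ge0 ?mulr_ge0 // enorm_sqr.
have := ler_dotv ut ut; rewrite ger0_norm ?dotv_ge0 // => /le_trans; apply.
by rewrite exprMn ler_wpM2r ?sqr_ge0 // expr2 ler_peMl.
Qed.

Lemma dist_to_le z y (E : set 'cV[R]_d) : E y -> dist_to z E <= enorm (z - y).
Proof.
move=> Ey; apply: ge_inf; last by exists y.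
by exists 0 => _ [w _ <-]; exact: enorm_ge0.
Qed.

(** From the orthogonal projection of [z] on the hyperplane; used to put points
    inside a thickening. *)
Lemma dist_to_hyperplane (n z : 'cV[R]_d) c : n != 0 ->
  dist_to z [set x | dotv n x = c] <= `|dotv n z - c| / enorm n.
Proof.
move=> n0; have nn : dotv n n != 0.
  apply: contraNneq n0 => nn; apply/eqP/matrixP => i j; rewrite !ord1 mxE.
  apply/eqP; rewrite -normr_le0 (le_trans (ler_entry_enorm _ _)) //.
  by rewrite /enorm nn sqrtr0.
have e0 : enorm n != 0.
  by apply: contra nn => /eqP e0; rewrite -enorm_sqr e0 expr0n.
pose y := z - ((dotv n z - c) / dotv n n) *: n.
have Ey : [set x | dotv n x = c] y.
  by rewrite /= dotvBr dotvZr divfK // subKr.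
have := dist_to_le z Ey.
rewrite subKr enormZ normrM normfV (ger0_norm (dotv_ge0 _)) -mulrA -enorm_sqr.
by rewrite expr2 invfM -mulrA mulVf // mulr1.
Qed.

End Euclid.

(** * Counting: pigeonholes and growth *)

Lemma pigeonhole_class (T : finType) (f : nat -> T) (s : seq nat) :
  s != [::] ->
  exists2 i0, i0 \in s & (size s <= #|T| * count (fun i => f i == f i0) s)%N.
Proof.
case: s => // i1 s _; set s' := i1 :: s.
have [|t Et] := bigop.eq_bigmax (fun t : T => count (fun i => f i == t) s').
  by apply/card_gt0P; exists (f i1).
have sz : (size s' <= #|T| * count (fun i => f i == t) s')%N.
  rewrite -Et -[X in (X <= _)%N]sum1_size.
  rewrite (partition_big f predT) //= -sum_nat_const; apply: leq_sum => u _.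
  by rewrite sum1_count (leq_bigmax (F := fun t => count (fun i => f i == t) s')).
have : has (fun i => f i == t) s'.
  by rewrite has_count lt0n; apply: contraTneq sz => ->; rewrite muln0.
by case/hasP => i0 i0s /eqP ft; exists i0; rewrite ?ft.
Qed.

Lemma interval_cells (R : realType) (D eta : R) : 0 < eta ->
  exists (g : nat) (cell : R -> 'I_g.+1), forall r r' : R,
    `|r| <= D -> `|r'| <= D -> cell r = cell r' -> `|r - r'| <= eta.
Proof.
move=> e0; pose g := Num.truncn (2 * D / eta).
exists g, (fun r => inord (Num.truncn ((r + D) / eta))) => r r' rD rD'.
have trle x : `|x| <= D -> 0 <= (x + D) / eta /\ (Num.truncn ((x + D) / eta) <= g)%N.
  rewrite ler_norml => /andP[x1 x2].
  have : 0 <= x + D by lra.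
  split; first by rewrite divr_ge0 // ltW.
  apply: le_truncn; rewrite ler_pM2r ?invr_gt0 //; lra.
have [r0 rg] := trle _ rD; have [r'0 r'g] := trle _ rD'.
move=> /(congr1 val); rewrite /= !inordK ?ltnS // => E.
have /andP[a1 a2] := truncn_itv r0; have /andP[b1 b2] := truncn_itv r'0.
move: a1 a2; rewrite E => a1 a2; rewrite -natr1 in a2 b2.
have -> : r - r' = ((r + D) / eta - (r' + D) / eta) * eta.
  by rewrite mulrBl !divfK ?gt_eqF //; lra.
by rewrite normrM (gtr0_norm e0) ler_piMl ?(ltW e0) // ler_norml; lra.
Qed.

(** The bound [g] depends on the box and on the precision, not on the list: this
    is what makes one move of Alice kill a fixed proportion of the hyperplanes,
    each hyperplane being encoded by a normal [v i] and an offset [c i]. *)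
Lemma pigeonhole_close (R : realType) (d : nat) (D eta : R) : 0 < eta ->
  exists g : nat, forall (s : seq nat) (v : nat -> 'cV[R]_d) (c : nat -> R),
    s != [::] ->
    {in s, forall i, (forall k, `|v i k 0| <= D) /\ `|c i| <= D} ->
    exists2 i0, i0 \in s &
      (size s <= g.+1 * count (fun i => [forall k, `|v i k 0 - v i0 k 0| <= eta]%R
                                   && (`|c i - c i0| <= eta)%R) s)%N.
Proof.
move=> e0; have [g [cell cellP]] := interval_cells D e0.
exists #|{: {ffun 'I_d -> 'I_g.+1} * 'I_g.+1}|.-1 => s v c s0 vc.
pose f i := ([ffun k => cell (v i k 0)], cell (c i)).
have [i0 i0s sz] := pigeonhole_class f s0; exists i0 => //.
rewrite prednK; last by apply/card_gt0P; exists (f 0%N).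
apply: leq_trans sz _; rewrite leq_mul2l; apply/orP; right.
rewrite (eq_in_count (_ : {in s, _ =1 fun i => (i \in s) && (f i == f i0)})).
  apply: sub_count => i /andP[is_ /eqP [Ev Ec]].
  have [vi ci] := vc _ is_; have [vi0 ci0] := vc _ i0s.
  rewrite cellP // andbT; apply/forallP => k; apply: cellP => //.
  by have /ffunP/(_ k) := Ev; rewrite !ffunE.
by move=> i /= ->.
Qed.

(** The length of a phase: [a * m.+1 + b] hyperplanes, of which a proportion
    [g / g.+1] survives each turn, are all gone after [m] turns.  Squaring
    Bernoulli's inequality gives quadratic growth, which is enough. *)
Lemma shrinking_beats_linear (g a b : nat) :
  exists m, ((a * m.+1 + b) * g ^ m < g.+1 ^ m)%N.
Proof.
case: g => [|g]; first by exists 1%N; rewrite exp0n // muln0.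
have bern n : (g.+1 ^ n * (g.+1 + n) <= g.+1 * g.+2 ^ n)%N.
  elim: n => [|n IH]; first by rewrite !expn0 mul1n muln1 addn0.
  rewrite !expnS; move: IH; move: (g.+1 ^ n)%N (g.+2 ^ n)%N => x y; nia.
pose n := (g.+1 ^ 2 * (3 * a + b)).+1.
exists (n + n)%N; have := leq_mul (bern n) (bern n).
rewrite !expnD => h.
rewrite -(ltn_pmul2l (_ : 0 < g.+1 * g.+1)%N) //.
have x0 : (0 < g.+1 ^ n * g.+1 ^ n)%N by rewrite muln_gt0 !expn_gt0.
have en : n = (g.+1 * g.+1 * (3 * a + b)).+1 by [].
have key : (g.+1 * g.+1 * (a * (n + n).+1 + b) < (g.+1 + n) * (g.+1 + n))%N.
  have : (a * (n + n).+1 + b <= n * (3 * a + b))%N by nia.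
  nia.
apply: leq_trans (_ : (g.+1 ^ n * g.+1 ^ n) * ((g.+1 + n) * (g.+1 + n)) <= _)%N.
  rewrite mulnA mulnC ltn_pmul2l //.
by move: h; rewrite mulnACA [X in (_ <= X)%N -> _]mulnACA.
Qed.

Section Geometric.
Variables (R : realType) (b : R).
Hypothesis b1 : 1 < b.

Lemma expr_unbounded r : exists n : nat, r < b ^+ n.
Proof.
have bern n : 1 + n%:R * (b - 1) <= b ^+ n.
  elim: n => [|n IH]; first by rewrite mul0r addr0 expr0.
  rewrite exprS -natr1.
  have n0 : 0 <= n%:R :> R by [].
  have c0 : 0 < b - 1 by rewrite subr_gt0.
  move: n0 c0 IH; move: (n%:R) (b ^+ n) => x y n0 c0 IH.
  have : 0 <= (y - (1 + x * (b - 1))) * b.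
    by rewrite mulr_ge0 ?subr_ge0 // ltW // (lt_trans ltr01).
  have : 0 <= x * (b - 1) ^+ 2 by rewrite mulr_ge0 ?sqr_ge0.
  nra.
exists (Num.Def.archi_bound (`|r| / (b - 1))).
apply: lt_le_trans (bern _).
have := archi_boundP (_ : 0 <= `|r| / (b - 1)).
rewrite divr_ge0 // ?subr_ge0 1?ltW // => /(_ isT).
rewrite ltr_pdivrMr ?subr_gt0 //; have := ler_norm r; lra.
Qed.

Lemma geometric_level (c r : R) : 0 < r ->
  exists n : nat, forall i, (i < n)%N = (b ^+ i * r <= c).
Proof.
move=> r0; have ex : exists n, ~~ (b ^+ n * r <= c).
  have [n hn] := expr_unbounded (c / r).
  by exists n; rewrite -ltNge -ltr_pdivrMr.
exists (ex_minn ex); case: ex_minnP => n hn minn i.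
apply/idP/idP => [lin|].
  by apply: contraLR lin => /minn; rewrite -leqNgt.
apply: contraTltn => ni; apply: contra hn; apply: le_trans.
by rewrite ler_pM2r // ler_weXn2l // ltW.
Qed.

End Geometric.

(** * Balls, and the move that halves the radius *)

Section Balls.
Variables (R : realType) (d : nat).
Implicit Types (B : eball R d) (x : 'cV[R]_d).

Lemma eball_center B : eball_set B (ecenter B).
Proof. by rewrite /eball_set /= subrr enorm0 ltW // eradius_gt0. Qed.

Lemma eball_entry B x : eball_set B x ->
  forall k, `|(x - ecenter B) k 0| <= eradius B.
Proof. by move=> Bx k; apply: le_trans (ler_entry_enorm _ _) Bx. Qed.

Lemma eball_diff_entry B x x' : eball_set B x -> eball_set B x' ->
  forall k, `|(x - x') k 0| <= 2 * eradius B.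
Proof.
move=> /eball_entry Bx /eball_entry Bx' k; have := Bx k; have := Bx' k.
by rewrite !mxE !ler_norml => /andP[? ?] /andP[? ?]; apply/andP; split; lra.
Qed.

Lemma eball_axis B k a : `|a| <= eradius B ->
  eball_set B (ecenter B + a *: delta_mx k 0).
Proof. by move=> aB; rewrite /eball_set /= addrC addKr enormZ enorm_delta mulr1. Qed.

(** False in dimension [0], where every ball is a point. *)
Lemma le_eradius (hd : (0 < d)%N) B B' :
  eball_set B' `<=` eball_set B -> eradius B' <= eradius B.
Proof.
move=> BB; pose k := Ordinal hd; have r0 := eradius_gt0 B'.
have h a : `|a| <= eradius B' -> `|ecenter B' k 0 + a - ecenter B k 0| <= eradius B.
  move=> /(eball_axis k)/BB/eball_entry/(_ k).
  by rewrite !mxE !eqxx mulr1.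
have := h (eradius B'); have := h (- eradius B').
rewrite normrN (ger0_norm (ltW r0)) lexx => /(_ isT) + /(_ isT).
by rewrite !ler_norml => /andP[? ?] /andP[? ?]; lra.
Qed.

(** If [B'] avoids a hyperplane through the centre of [B], it lies on one side of
    it, so its diameter fits in a radius of [B]. *)
Lemma center_move (hd : (0 < d)%N) (beta : R) B : 0 < beta ->
  exists m, alice_legal beta B m /\
    forall B', bob_legal beta B m B' -> 2 * eradius B' <= eradius B.
Proof.
move=> b0; pose k := Ordinal hd; pose e : 'cV[R]_d := delta_mx k 0.
have r0 := eradius_gt0 B.
exists ([set x | dotv e x = ecenter B k 0], beta * eradius B); split.
  split=> //=; last by rewrite mulr_gt0.
  exists e, (ecenter B k 0); split=> //.
  by apply/eqP => /matrixP/(_ k 0)/eqP; rewrite !mxE !eqxx oner_eq0.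
move=> B' [BB _ /seteqP[dis _]]; have r'0 := eradius_gt0 B'.
pose h := ecenter B' k 0 - ecenter B k 0.
(* otherwise the point of B' facing its centre lies on the removed hyperplane *)
have rh : eradius B' < `|h|.
  rewrite ltNge; apply/negP => hr.
  have := @eball_axis B' k (- h); rewrite normrN => /(_ hr) Bx.
  apply: (dis (ecenter B' + - h *: delta_mx k 0)); split => //=.
  rewrite /thickening /=; set z := _ + _.
  apply: le_trans (_ : enorm (z - z) <= _); last first.
    by rewrite subrr enorm0 ltW // mulr_gt0.
  apply: dist_to_le; rewrite /= dotv_delta !mxE !eqxx mulr1 /h.
  by rewrite opprB addrC subrK.
have hB a : `|a| <= eradius B' -> `|h + a| <= eradius B.
  move=> /(eball_axis k)/BB/eball_entry/(_ k).
  by rewrite !mxE !eqxx mulr1 /h addrAC.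
have h1 := hB (eradius B'); have h2 := hB (- eradius B').
move: h1 h2; rewrite normrN (ger0_norm (ltW r'0)) lexx => /(_ isT) + /(_ isT).
move: rh; rewrite !ler_norml; case: (ger0P h) => h0 ? /andP[? ?] /andP[? ?]; lra.
Qed.

End Balls.

(** * The move that kills a proportion of the live hyperplanes *)

Section Lacunary.
Variables (R : realType) (d : nat) (hd : (0 < d)%N) (b beta : R).
Variable y : nat -> 'cV[R]_d.
Hypotheses (b1 : 1 < b) (beta0 : 0 < beta) (beta1 : beta < 1).
Hypothesis y_up : forall i k, `|y i k 0| <= b ^+ i.
Hypothesis y_lo : forall i, exists k, b ^+ i <= b * `|y i k 0|.
Implicit Types (B S : eball R d) (x : 'cV[R]_d).

(** Small enough for [y_i . x] to vary by at most [1/4] on a ball of radius [rho]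
    when [b ^+ i * rho] is below it: such a ball meets the neighbourhoods of at
    most one hyperplane [y_i . x = p] (see [hits_unique]). *)
Definition separation_scale : R := (8 * d%:R)^-1.

Definition level B : nat :=
  projT1 (cid (geometric_level b1 separation_scale (eradius_gt0 B))).

Lemma levelP B i : (i < level B)%N = (b ^+ i * eradius B <= separation_scale).
Proof. by rewrite /level; case: cid. Qed.

Definition hits (delta : R) i B :=
  exists (p : int) x, eball_set B x /\ `|dotv (y i) x - p%:~R| < delta.

(** The ball [S] where the current phase started decides which indices are under
    consideration, so that no index is added during a phase. *)
Definition live (delta : R) S B : seq nat :=
  [seq i <- iota 0 (level S) | `[< hits delta i B >]].

Lemma mem_live (delta : R) S B i :
  (i \in live delta S B) = (i < level S)%N && `[< hits delta i B >].
Proof. by rewrite mem_filter mem_iota add0n andbC. Qed.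

Lemma hits_sub (delta : R) i B B' :
  eball_set B' `<=` eball_set B -> hits delta i B' -> hits delta i B.
Proof. by move=> BB [p [x [/BB Bx xp]]]; exists p, x. Qed.

Lemma size_live_sub (delta : R) S B B' :
  eball_set B' `<=` eball_set B ->
  (size (live delta S B') <= size (live delta S B))%N.
Proof.
move=> BB; rewrite !size_filter; apply: sub_count => i /asboolP hi.
by apply/asboolP/(hits_sub BB).
Qed.

Lemma b_gt0 : 0 < b. Proof. exact: lt_trans ltr01 b1. Qed.
Lemma bX_gt0 i : 0 < b ^+ i. Proof. by rewrite exprn_gt0 // b_gt0. Qed.

Lemma hits_unique (delta : R) S B B' i p p' x x' :
  delta <= 8^-1 -> (i < level S)%N -> eradius B <= eradius S ->
  eball_set B' `<=` eball_set B ->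
  eball_set B x -> `|dotv (y i) x - p%:~R| < delta ->
  eball_set B' x' -> `|dotv (y i) x' - p'%:~R| < delta -> p' = p :> int.
Proof.
move=> d8; rewrite levelP => lS rBS BB Bx xp /BB Bx' xp'.
have d0 : 0 < d%:R :> R by rewrite ltr0n.
have := ler_dotv (y_up i) (eball_diff_entry Bx' Bx); rewrite dotvBr => hh.
have {}hh : `|dotv (y i) x' - dotv (y i) x| <= 4^-1.
  apply: le_trans hh _.
  have -> : d%:R * (b ^+ i * (2 * eradius B)) = (2 * d%:R) * (b ^+ i * eradius B) by ring.
  apply: le_trans (_ : (2 * d%:R) * separation_scale <= _).
    rewrite ler_pM2l; last by rewrite mulr_gt0.
    by apply: le_trans lS; rewrite ler_pM2l // bX_gt0.
  by rewrite /separation_scale invfM mulrACA divff ?gt_eqF // mulr1; lra.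
have : `|(p' - p)%:~R : R| < 1.
  rewrite intrB; move: xp xp' hh; rewrite !ltr_norml !ler_norml.
  by move=> /andP[? ?] /andP[? ?] /andP[? ?]; apply/andP; split; lra.
by rewrite -intr_norm -[1]/(1%:~R) ltr_int; lia.
Qed.

(** The hyperplane of index [i] is recorded by its equation relative to the centre
    of [B], with [y_i] scaled by [b ^- i] and lengths by [eradius B]; these data
    stay in a fixed box.  Two hyperplanes with nearby data are within
    [beta * eradius B] of each other inside [B], so the thickening of one swallows
    the other. *)
Lemma killing_move : exists g : nat, forall (delta : R) S B,
  0 < delta -> delta <= 8^-1 -> eradius B <= eradius S ->
  live delta S B != [::] ->
  {in live delta S B, forall i, 2 * b * delta <= beta * (b ^+ i * eradius B)} ->
  exists m, alice_legal beta B m /\ forall B', bob_legal beta B m B' ->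
    (size (live delta S B') * g.+1 <= size (live delta S B) * g)%N.
Proof.
have D0 : 0 < d%:R :> R by rewrite ltr0n.
have bp := b_gt0.
pose eta : R := beta / (2 * b * (d%:R + 1)).
(* The errors from the d coordinates of the normal and from the offset add up to
   half of the thickness of the removed slab; the other half absorbs delta. *)
have eta0 : 0 < eta by rewrite divr_gt0 ?mulr_gt0 ?addr_gt0.
have [g pig] := @pigeonhole_close R d (d%:R + 1) eta eta0.
exists g => delta S B del0 del8 rBS live0 liveP.
have r0 := eradius_gt0 B; set r := eradius B in r0 liveP rBS *.
have /choice[p pP] : forall i, exists p : int, i \in live delta S B ->
    exists x, eball_set B x /\ `|dotv (y i) x - p%:~R| < delta.
  move=> i; case: (boolP (i \in live delta S B)) => [|_]; last by exists 0.
  by rewrite mem_live => /andP[_ /asboolP[p h]]; exists p.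
pose v i := (b ^+ i)^-1 *: y i.
pose c i := (p i)%:~R / (b ^+ i * r) - dotv (v i) (ecenter B) / r.
have small i : i \in live delta S B -> delta / b ^+ i <= beta * r / (2 * b).
  move=> /liveP; have bi := bX_gt0 i.
  rewrite ler_pdivrMr // (_ : _ * b ^+ i = beta * (b ^+ i * r) / (2 * b)); last by ring.
  by rewrite ler_pdivlMr ?mulr_gt0 // => h; lra.
have eq_c i x : dotv (v i) (x - ecenter B) - c i * r
    = (dotv (y i) x - (p i)%:~R) / b ^+ i.
  have bi := bX_gt0 i.
  rewrite /c /v !dotvZl dotvBr; field.
  by rewrite !gt_eqF.
have vle i k : `|v i k 0| <= 1.
  rewrite mxE normrM normfV (ger0_norm (ltW (bX_gt0 i))) mulrC.
  by rewrite ler_pdivrMr ?bX_gt0 // mul1r y_up.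
have bnd : {in live delta S B, forall i,
    (forall k, `|v i k 0| <= d%:R + 1) /\ `|c i| <= d%:R + 1}.
  move=> i iL; split=> [k|]; first by apply: le_trans (vle _ _) _; lra.
  have [x [Bx xp]] := pP i iL.
  have h1 := ler_dotv (vle i) (eball_entry Bx).
  have h2 : `|(dotv (y i) x - (p i)%:~R) / b ^+ i| <= r.
    have bi := bX_gt0 i.
    rewrite normrM normfV (ger0_norm (ltW bi)).
    apply: le_trans (_ : delta / b ^+ i <= _).
      by rewrite ler_pM2r ?invr_gt0 // ltW.
    apply: le_trans (small i iL) _; rewrite ler_pdivrMr ?mulr_gt0 //.
    by rewrite (mulrC beta) ler_pM2l //; move: b1 beta1; lra.
  rewrite -eq_c in h2.
  suff : `|c i * r| <= (d%:R + 1) * r by rewrite normrM (ger0_norm (ltW r0)) ler_pM2r.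
  move: h1 h2; rewrite -/r mul1r (mulrDl d%:R) mul1r !ler_norml.
  by move=> /andP[? ?] /andP[? ?]; apply/andP; split; lra.
have [i0 i0L sz] := pig _ v c live0 bnd.
have vi0 : b^-1 <= enorm (v i0).
  have [k bk] := y_lo i0; apply: le_trans (ler_entry_enorm _ k).
  rewrite mxE normrM normfV (ger0_norm (ltW (bX_gt0 i0))).
  by rewrite ler_pdivlMl ?bX_gt0 // mulrC ler_pdivrMl.
exists ([set x | dotv (v i0) x = dotv (v i0) (ecenter B) + c i0 * r], beta * r).
split.
  split=> //=; last by rewrite mulr_gt0.
  exists (v i0), (dotv (v i0) (ecenter B) + c i0 * r); split=> //.
  by apply: contraTneq vi0 => ->; rewrite enorm0 -ltNge invr_gt0.
have v0 : v i0 != 0.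
  by apply: contraTneq vi0 => ->; rewrite enorm0 -ltNge invr_gt0.
move=> B' [BB _ /seteqP[dis _]].
pose close i := [forall k, `|v i k 0 - v i0 k 0| <= eta] && (`|c i - c i0| <= eta).
have far i : i \in live delta S B' -> ~~ close i.
  move=> iL'; apply/negP => /andP[/forallP vclose cclose].
  move: (iL'); rewrite mem_live => /andP[iS /asboolP[p' [x [B'x xp']]]].
  have iL : i \in live delta S B.
    by rewrite mem_live iS; apply/asboolP/(hits_sub BB); exists p', x.
  have [x0 [Bx0 xp0]] := pP i iL.
  (* the integer seen from B' is the one recorded for B *)
  have pp := hits_unique del8 iS rBS BB Bx0 xp0 B'x xp'.
  rewrite pp in xp'; apply: (dis x); split=> //=; rewrite /thickening /=.
  apply: le_trans (dist_to_hyperplane _ _ v0) _.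
  rewrite ler_pdivrMr ?(lt_le_trans _ vi0) ?invr_gt0 //.
  apply: le_trans (_ : beta * r * b^-1 <= _); last first.
    by rewrite ler_pM2l // mulr_gt0.
  have h1 : `|dotv (v i) (x - ecenter B) - c i * r| <= beta * r / (2 * b).
    have bi := bX_gt0 i; rewrite eq_c normrM normfV (ger0_norm (ltW bi)).
    apply: le_trans (small i iL).
    by rewrite ler_pM2r ?invr_gt0 // ltW.
  have h2 : `|dotv (v i - v i0) (x - ecenter B)| <= d%:R * (eta * r).
    apply: ler_dotv => [k|]; last exact: eball_entry (BB _ B'x).
    by have := vclose k; rewrite !mxE.
  have h3 : `|(c i - c i0) * r| <= eta * r.
    by rewrite normrM (ger0_norm (ltW r0)) ler_pM2r.
  have e1 : d%:R * (eta * r) + eta * r = beta * r / (2 * b).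
    by rewrite /eta; field; rewrite !gt_eqF ?addr_gt0.
  have e2 : beta * r / b = beta * r / (2 * b) + beta * r / (2 * b).
    by field; rewrite gt_eqF.
  move: h1 h2 h3; rewrite e2 dotvBl (mulrBl r (c i)) !dotvBr !ler_norml.
  by move=> /andP[? ?] /andP[? ?] /andP[? ?]; apply/andP; split; lra.
have count_sub : (size (live delta S B') + count close (live delta S B)
                  <= size (live delta S B))%N.
  rewrite -(count_predC close (live delta S B)) addnC leq_add2l.
  rewrite -size_filter; apply: uniq_leq_size; first by rewrite filter_uniq // iota_uniq.
  move=> i iL'; rewrite mem_filter /= far //.
  move: iL'; rewrite !mem_live => /andP[-> /asboolP h] /=.
  by apply/asboolP/(hits_sub BB).
move: count_sub sz; rewrite /close => count_sub sz.
have := leq_mul count_sub (leqnn g.+1); rewrite mulnDl => h.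
rewrite -(leq_add2r (size (live delta S B))) [X in (_ <= X)%N]addnC -mulnS.
by apply: leq_trans h; rewrite leq_add2l mulnC.
Qed.

(** The specification from which Alice's strategy is built. *)
Definition shrinking_move g (delta : R) S B (m : alice_move R d) : Prop :=
  [/\ alice_legal beta B m,
      live delta S B = [::] -> forall B', bob_legal beta B m B' ->
        2 * eradius B' <= eradius B &
      0 < delta -> delta <= 8^-1 -> eradius B <= eradius S ->
      {in live delta S B, forall i, 2 * b * delta <= beta * (b ^+ i * eradius B)} ->
      forall B', bob_legal beta B m B' ->
        (size (live delta S B') * g.+1 <= size (live delta S B) * g)%N].

Lemma shrinking_move_exists : exists g, forall (delta : R) S B,
  exists m, shrinking_move g delta S B m.
Proof.
have [g kill] := killing_move; exists g => delta S B.
have [m0 [leg0 cen]] := center_move hd B beta0.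
have [L0|L0] := eqVneq (live delta S B) [::].
  exists m0; split=> // _ _ _ _ B' [BB _ _].
  by have := size_live_sub delta S BB; rewrite L0 leqn0 => /eqP ->.
have [[d0 d8 rB lv]|no] := pselect [/\ 0 < delta, delta <= 8^-1,
    eradius B <= eradius S &
    {in live delta S B, forall i, 2 * b * delta <= beta * (b ^+ i * eradius B)}].
  have [m [leg km]] := kill _ _ _ d0 d8 rB L0 lv.
  by exists m; split=> // L1; rewrite L1 in L0.
by exists m0; split=> // d0 d8 rB lv; case: no.
Qed.
End Lacunary.

(** * The strategy by phases *)

Lemma nested_subset (R : realType) (d : nat) (B : nat -> eball R d) :
  (forall n, eball_set (B n.+1) `<=` eball_set (B n)) ->
  forall n r, eball_set (B (n + r)%N) `<=` eball_set (B n).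
Proof.
move=> BB n; elim=> [|r IH]; first by rewrite addn0.
by rewrite addnS => x /BB /IH.
Qed.

(** Coordinatewise suprema of the left ends only give a point within the radius
    in each coordinate; the vanishing of the radii upgrades this to the Euclidean
    norm. *)
Lemma nested_balls_meet (R : realType) (d : nat) (hd : (0 < d)%N) (B : nat -> eball R d) :
  (forall n, eball_set (B n.+1) `<=` eball_set (B n)) ->
  (forall e, 0 < e -> exists n, eradius (B n) < e) ->
  exists x, forall n, eball_set (B n) x.
Proof.
move=> BB small; have nest := nested_subset BB.
pose lo n k := ecenter (B n) k 0 - eradius (B n).
have cc m n k : lo m k <= ecenter (B n) k 0 + eradius (B n).
  have := eball_entry (@nest m n _ (eball_center _)) k.
  rewrite addnC; have := eball_entry (@nest n m _ (eball_center _)) k.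
  rewrite !mxE !ler_norml => /andP[? ?] /andP[? ?].
  by rewrite /lo; lra.
pose x : 'cV[R]_d := \col_k sup (range (lo ^~ k)).
have xc n k : `|(x - ecenter (B n)) k 0| <= eradius (B n).
  have h1 : lo n k <= x k 0.
    rewrite mxE; apply: ub_le_sup; last by exists n.
    by exists (ecenter (B n) k 0 + eradius (B n)) => _ [m _ <-].
  have h2 : x k 0 <= ecenter (B n) k 0 + eradius (B n).
    rewrite mxE; apply: ge_sup; first by exists (lo n k), n.
    by move=> _ [m _ <-].
  rewrite !mxE in h1 h2 *; rewrite ler_norml; apply/andP.
  by rewrite /lo in h1 *; split; lra.
exists x => n; apply/ler_addgt0Pr => e e0; rewrite /eball_set /=.
have [N NP] := small (e / (d%:R + 1)) (divr_gt0 e0 (ltr_wpDl (ler0n _ _) ltr01)).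
have rle : eradius (B (N + n)%N) <= eradius (B N) by apply: (le_eradius hd); exact: nest.
have -> : x - ecenter (B n) = (x - ecenter (B (N + n)%N))
                            + (ecenter (B (N + n)%N) - ecenter (B n)).
  by rewrite addrA subrK.
apply: le_trans (ler_enormD _ _) _; rewrite addrC; apply: lerD.
  by rewrite addnC; apply: (@nest n N); exact: eball_center.
apply: le_trans (enorm_le_bound (xc _)) _.
move: NP; rewrite ltr_pdivlMr ?ltr_wpDl // => NP.
apply: le_trans (ltW NP); have r0 := eradius_gt0 (B N).
apply: le_trans (_ : d%:R * eradius (B N) <= _); first by rewrite ler_wpM2l.
by rewrite mulrC ler_pM2l // lerDl.
Qed.

Section Strategy.
Variables (R : realType) (d : nat) (hd : (0 < d)%N) (b beta : R).
Variable y : nat -> 'cV[R]_d.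
Hypotheses (b1 : 1 < b) (beta0 : 0 < beta) (beta1 : beta < 1).
Hypothesis y_up : forall i k, `|y i k 0| <= b ^+ i.
Hypothesis y_lo : forall i, exists k, b ^+ i <= b * `|y i k 0|.
Implicit Types (B S : eball R d) (x : 'cV[R]_d).

Let c0 : R := separation_scale R d.
Let c0_gt0 : 0 < c0. Proof. by rewrite invr_gt0 mulr_gt0 // ltr0n. Qed.
Let b0 : 0 < b. Proof. exact: b_gt0 b1. Qed.

(** A complete play in which Alice answers [B n] by [move delta S (B n)], where
    [S] is the last ball whose index is a multiple of the phase length [m.+1]. *)
Section Play.
Variables (g a m : nat) (move : R -> eball R d -> eball R d -> alice_move R d).
Hypothesis moveP : forall (delta : R) S B, shrinking_move beta y b1 g delta S B (move delta S B).
Hypothesis a_large : 1 <= beta * b ^+ a.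
Variables (B : nat -> eball R d) (delta : R).
Hypothesis m_large : ((a * m.+1 + level b1 (B 0%N)) * g ^ m < g.+1 ^ m)%N.
Hypotheses (delta_gt0 : 0 < delta) (delta8 : delta <= 8^-1).
(* A newcomer has [c0 < b ^+ i * rho] for the radius [rho] at which the preceding
   phase started; that phase and the current one each reduce the radius by a
   factor [beta ^+ m.+1] at most. *)
Hypothesis delta_le : 2 * b * delta <= beta * (beta ^+ m.+1 * (c0 * beta ^+ m.+1)).
(* In the first phase [b ^+ i] is only known to be at least [1]. *)
Hypothesis delta_le0 : 2 * b * delta <= beta * (beta ^+ m.+1 * eradius (B 0%N)).
Hypothesis B_legal : forall n,
  bob_legal beta (B n) (move delta (B (n - n %% m.+1)%N) (B n)) (B n.+1).

Let nested n : eball_set (B n.+1) `<=` eball_set (B n).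
Proof. by case: (B_legal n). Qed.

Let radius_ge n r : beta ^+ r * eradius (B n) <= eradius (B (n + r)%N).
Proof.
elim: r => [|r IH]; first by rewrite expr0 mul1r addn0.
rewrite addnS exprS -mulrA; have [_ h _] := B_legal (n + r)%N.
by apply: le_trans h; rewrite ler_pM2l.
Qed.

Let radius_le n r : eradius (B (n + r)%N) <= eradius (B n).
Proof. apply: (le_eradius hd); exact: nested_subset. Qed.

Let start t : nat := (t * m.+1)%N.

Let live_at t r := live y b1 delta (B (start t)) (B (start t + r)%N).

(** The invariant at the start of a phase: every live hyperplane is large enough
    to be killed at any time of the phase, and there are few of them. *)
Let ready t :=
  {in live_at t 0, forall i, 2 * b * delta
      <= beta * (beta ^+ m.+1 * (b ^+ i * eradius (B (start t))))}
  /\ (size (live_at t 0) <= a * m.+1 + level b1 (B 0%N))%N.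

Let legal_in_phase t r : (r < m.+1)%N ->
  bob_legal beta (B (start t + r)) (move delta (B (start t)) (B (start t + r)))
    (B (start t + r.+1)).
Proof.
move=> rm; have := B_legal (start t + r)%N.
by rewrite /start modnMDl modn_small // addnK addnS.
Qed.

Let phase_decay t r : ready t -> (r <= m)%N ->
  (size (live_at t r) * g.+1 ^ r <= size (live_at t 0) * g ^ r)%N.
Proof.
move=> [rt _]; elim: r => [|r IH] rm; first by rewrite !expn0.
have [_ _ /(_ delta_gt0 delta8 (radius_le _ _))] :=
  moveP delta (B (start t)) (B (start t + r)%N).
move=> /(_ _ _ (legal_in_phase t (leqW rm))) h.
have {}h : (size (live_at t r.+1) * g.+1 <= size (live_at t r) * g)%N.
  apply: h => i; rewrite mem_live => /andP[iS /asboolP hi].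
  have iL : i \in live_at t 0.
    rewrite mem_live iS; apply/asboolP; apply: hits_sub hi.
    by rewrite addn0; exact: nested_subset.
  apply: le_trans (rt i iL) _; rewrite ler_pM2l // mulrCA ler_pM2l ?bX_gt0 //.
  apply: le_trans (radius_ge _ _); rewrite ler_pM2r ?eradius_gt0 //.
  by apply: ler_wiXn2l; rewrite ?ltW // ltnW // ltnW.
rewrite !expnS; apply: leq_trans (_ : size (live_at t r) * g * g.+1 ^ r <= _)%N.
  by rewrite mulnA leq_mul2r h orbT.
by rewrite mulnAC mulnA (mulnAC (size (live_at t 0))) leq_mul2r IH ?orbT // ltnW.
Qed.

(** The last turn of the phase, number [m], is thus played with nothing live. *)
Let phase_clear t : ready t -> live_at t m = [::].
Proof.
move=> rt; have [_ sz] := rt; have := phase_decay rt (leqnn m).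
case: (live_at t m) => // i s h; exfalso; move: h; apply/negP; rewrite -ltnNge.
apply: leq_ltn_trans (_ : (a * m.+1 + level b1 (B 0%N)) * g ^ m < _)%N.
  by rewrite leq_mul2r sz orbT.
by apply: leq_trans m_large _; rewrite /= leq_pmull.
Qed.

Let phase_halves t : ready t ->
  2 * eradius (B (start t.+1)) <= eradius (B (start t)).
Proof.
move=> /phase_clear clr.
have [_ /(_ clr) h _] := moveP delta (B (start t)) (B (start t + m)%N).
have -> : start t.+1 = (start t + m.+1)%N by rewrite /start mulSn addnC.
by apply: le_trans (h _ (legal_in_phase t (ltnSn m))) (radius_le _ _).
Qed.

Let phase_end t : ready t -> live y b1 delta (B (start t)) (B (start t.+1)) = [::].
Proof.
move=> /phase_clear clr; apply/eqP; rewrite -size_eq0 -leqn0.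
have <- : size (live_at t m) = 0%N by rewrite clr.
apply: size_live_sub; rewrite /start mulSn addnC addnS; exact: nested.
Qed.

Let next_radius t : beta ^+ m.+1 * eradius (B (start t)) <= eradius (B (start t.+1)).
Proof. by have := radius_ge (start t) m.+1; rewrite /start mulSn addnC. Qed.

(** This is where lacunarity bounds the number of newcomers. *)
Let level_step t : (level b1 (B (start t.+1)) <= a * m.+1 + level b1 (B (start t)))%N.
Proof.
rewrite leqNgt; apply/negP; rewrite levelP exprD => h.
suff : (level b1 (B (start t)) < level b1 (B (start t)))%N by rewrite ltnn.
rewrite levelP; apply: le_trans h; set k := level _ _.
rewrite exprM -!mulrA.
apply: le_trans (_ : (b ^+ a) ^+ m.+1 * (b ^+ k * (beta ^+ m.+1 * eradius (B (start t)))) <= _).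
  rewrite mulrCA [X in _ <= X](_ : _ = b ^+ k * ((beta * b ^+ a) ^+ m.+1 * eradius (B (start t)))).
    rewrite ler_pM2l ?bX_gt0 // ler_peMl ?exprn_ege1 //.
    exact: ltW (eradius_gt0 _).
  by rewrite exprMn; ring.
by rewrite ler_pM2l ?exprn_gt0 // ler_pM2l ?exprn_gt0.
Qed.

Let ready_start : ready 0.
Proof.
split=> [i _|]; last first.
  rewrite size_filter (leq_trans (count_size _ _)) // size_iota.
  by rewrite /start mul0n leq_addl.
apply: le_trans delta_le0 _; rewrite /start mul0n ler_pM2l // ler_pM2l ?exprn_gt0 //.
by rewrite ler_peMl ?exprn_ege1 // ltW ?eradius_gt0.
Qed.

(** What is live at the start of a phase is new: older indices were disposed of
    in the previous phase. *)
Let live_next_level t i : ready t -> i \in live_at t.+1 0 ->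
  (level b1 (B (start t)) <= i)%N.
Proof.
move=> /phase_end clr; rewrite mem_live addn0 => /andP[_ hi].
rewrite leqNgt; apply/negP => it.
by have : i \in [::] by rewrite -clr mem_live it.
Qed.

Let ready_next t : ready t -> ready t.+1.
Proof.
move=> rt; split=> [i /(live_next_level rt)|].
  rewrite leqNgt levelP -ltNge => /ltW hi.
  apply: le_trans delta_le _; rewrite ler_pM2l // ler_pM2l ?exprn_gt0 //.
  apply: le_trans (_ : b ^+ i * (beta ^+ m.+1 * eradius (B (start t))) <= _).
    by rewrite mulrCA mulrC ler_pM2l ?exprn_gt0.
  by rewrite ler_pM2l ?exprn_gt0.
have sub : {subset live_at t.+1 0 <=
    iota (level b1 (B (start t))) (level b1 (B (start t.+1)) - level b1 (B (start t)))}.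
  move=> i iL; have := live_next_level rt iL.
  by move: iL; rewrite mem_live mem_iota => /andP[? _] ?; lia.
apply: leq_trans (uniq_leq_size _ sub) _; first by rewrite filter_uniq // iota_uniq.
rewrite size_iota leq_subLR; apply: leq_trans (level_step t) _.
by rewrite addnC leq_add2l leq_addr.
Qed.

Let ready_all t : ready t.
Proof. by elim: t => [|t IH]; [exact: ready_start|exact: ready_next]. Qed.

Let radius_pow t : 2 ^+ t * eradius (B (start t)) <= eradius (B 0%N).
Proof.
elim: t => [|t IH]; first by rewrite expr0 mul1r /start mul0n.
apply: le_trans IH; rewrite exprSr -mulrA ler_pM2l ?exprn_gt0 //.
exact: phase_halves (ready_all t).
Qed.

Let radius_small e : 0 < e -> exists t, eradius (B (start t)) < e.
Proof.
move=> e0; have [t ht] := expr_unbounded (ltr1n R 2) (eradius (B 0%N) / e).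
exists t; move: ht; rewrite ltr_pdivrMr // => /(le_lt_trans (radius_pow t)).
by rewrite ltr_pM2l ?exprn_gt0.
Qed.

(** If [y_i . x] were within [delta] of an integer, [i] would be live at the end of
    every phase that starts with a small enough radius. *)
Lemma play_outcome : exists2 x, forall n, eball_set (B n) x
  & forall i (p : int), delta <= `|dotv (y i) x - p%:~R|.
Proof.
have [|x Bx] := nested_balls_meet hd nested.
  by move=> e /radius_small[t]; exists (start t).
exists x => // i p; rewrite leNgt; apply/negP => xp.
have [t tP] := radius_small (divr_gt0 c0_gt0 (bX_gt0 b1 i)).
have : i \in live y b1 delta (B (start t)) (B (start t.+1)).
  rewrite mem_live levelP mulrC -ler_pdivlMr ?bX_gt0 // (ltW tP) /=.
  by apply/asboolP; exists p, x.
by rewrite (phase_end (ready_all t)).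
Qed.

End Play.

(** Alice reads off the list of balls its first ball, the ball where the current
    phase started and the current ball, and plays accordingly. *)
Theorem lacunary_absolute_winning :
  hyperplane_absolute_winning_at beta
    [set x | exists2 delta, 0 < delta &
       forall i (p : int), delta <= `|dotv (y i) x - p%:~R|].
Proof.
have [g gP] := shrinking_move_exists hd b1 beta0 beta1 y_up y_lo.
have /choice[move3 move3P] : forall q : R * eball R d * eball R d, exists m,
    shrinking_move beta y b1 g q.1.1 q.1.2 q.2 m.
  by move=> [[delta S] B]; exact: gP.
pose move delta S B := move3 (delta, S, B).
have moveP delta S B : shrinking_move beta y b1 g delta S B (move delta S B).
  exact: (move3P (delta, S, B)).
have [a] := expr_unbounded b1 beta^-1.
rewrite -[beta^-1]mul1r ltr_pdivrMr // mulrC => /ltW a_large.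
have /choice[len lenP] : forall B, exists m,
    ((a * m.+1 + level b1 B) * g ^ m < g.+1 ^ m)%N.
  by move=> B; exact: shrinking_beats_linear.
(* The phase length and delta depend on Bob's first ball, through the number of
   hyperplanes that are in play from the beginning. *)
pose margin B : R := Num.min 8^-1 (Num.min
  (beta * (beta ^+ (len B).+1 * (c0 * beta ^+ (len B).+1)) / (2 * b))
  (beta * (beta ^+ (len B).+1 * eradius B) / (2 * b))).
pose B_ : eball R d := EBall 0 ltr01.
pose sigma (Bs : seq (eball R d)) := let n := (size Bs).-1 in
  let first := nth B_ Bs 0 in
  move (margin first) (nth B_ Bs (n - n %% (len first).+1)) (nth B_ Bs n).
have responseE (B : nat -> eball R d) n : response sigma B n =
    move (margin (B 0%N)) (B (n - n %% (len (B 0%N)).+1)%N) (B n).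
  by rewrite /response /sigma size_mkseq /= !nth_mkseq // ltnS leq_subr.
exists sigma; split=> [B n _|B legal].
  by rewrite responseE; case: (moveP (margin (B 0%N)) (B (n - n %% (len (B 0%N)).+1)%N) (B n)).
have margin_gt0 : 0 < margin (B 0%N).
  have r0 := eradius_gt0 (B 0%N); have bp k : 0 < beta ^+ k by rewrite exprn_gt0.
  rewrite /margin !lt_min; apply/and3P.
  by split; rewrite ?invr_gt0 // ?divr_gt0 // ?mulr_gt0 // ?mulr_gt0.
have [|||n|x Bx xP] := @play_outcome g a (len (B 0%N)) move moveP a_large B (margin (B 0%N))
  (lenP _) margin_gt0.
- by rewrite ge_min lexx.
- by rewrite mulrC -ler_pdivlMr ?mulr_gt0 // /margin !ge_min lexx orbT.
- by rewrite mulrC -ler_pdivlMr ?mulr_gt0 // /margin !ge_min lexx !orbT.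
- by rewrite -responseE; apply: (legal n.+1).
by exists x; split; [exists (margin (B 0%N))|move=> n _; exact: Bx].
Qed.

End Strategy.

(** * Best dual approximations *)

Lemma argmin_in_box (R : realType) (M T : nat) (P : pred 'cV[int]_M)
    (F : 'cV[int]_M -> R) :
  (forall y, P y -> forall k, (`|y k 0%R| <= T)%N) -> (exists y, P y) ->
  exists w, P w /\ forall y, P y -> F w <= F y.
Proof.
move=> box [y0 Py0].
pose dec (t : {ffun 'I_M -> 'I_(T + T).+1}) : 'cV[int]_M :=
  \col_k ((t k : nat)%:Z - T%:Z).
have decP y : P y -> exists t, dec t = y.
  move=> /box yT; exists [ffun k => inord (absz (y k 0 + T%:Z))].
  apply/matrixP => k j; rewrite !mxE ffunE (ord1 j) inordK; have := yT k; lia.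
have [t0 Et0] := decP _ Py0.
have Pt0 : P (dec t0) by rewrite Et0.
case: (arg_minP (F \o dec) (Pt0 : [pred t | P (dec t)] t0)) => t Pt tmin.
exists (dec t); split=> // y Py; have [u Eu] := decP _ Py.
by rewrite -Eu; apply: tmin; rewrite inE /= Eu.
Qed.

Section DistanceToZ.
Variable R : realType.

Definition distZ (a : R) : R := `|a - (Num.floor (a + 2^-1))%:~R|.

Lemma distZ_le a (p : int) : distZ a <= `|a - p%:~R|.
Proof.
have /andP[] := floor_itv (a + 2^-1); rewrite /distZ; set n := Num.floor _.
rewrite intrD => h1 h2; have [->//|pn] := eqVneq p n.
have [lpn|lnp] : (p + 1 <= n \/ n + 1 <= p)%R by move: pn; lia.
  have : (p + 1)%:~R <= n%:~R :> R by rewrite ler_int.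
  rewrite intrD => h3; rewrite [leRHS]ger0_norm ?ler_norml; last lra.
  by apply/andP; split; lra.
have : (n + 1)%:~R <= p%:~R :> R by rewrite ler_int.
rewrite intrD => h3; rewrite [leRHS]ler0_norm ?ler_norml; last lra.
by apply/andP; split; lra.
Qed.

End DistanceToZ.

Section Dirichlet.
Variables (R : realType) (M N : nat) (A : 'M[R]_(M, N)).

Definition dual_form (y : 'cV[int]_M) : 'cV[R]_N := A^T *m map_mx intr y.

(** The distance from [A^T y] to the integer lattice, in the l1 norm. *)
Definition dual_error (y : 'cV[int]_M) : R := \sum_k distZ (dual_form y k 0).

(** Dirichlet's pigeonhole: more vectors [y] in the box than cells of side [1 / K]
    in the torus of dimension [N]. *)
Lemma dirichlet (T K : nat) : (0 < K)%N -> (K ^ N < T.+1 ^ M)%N ->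
  exists y : 'cV[int]_M, [/\ y != 0, forall k, (`|y k 0%R| <= T)%N &
    forall k, distZ (dual_form y k 0) <= K%:R^-1].
Proof.
case: K => // K _ KT.
pose dec (t : {ffun 'I_M -> 'I_T.+1}) : 'cV[int]_M := \col_k (t k : nat)%:Z.
pose fr (a : R) : R := a - (Num.floor a)%:~R.
have fr_ge0 a : 0 <= K.+1%:R * fr a.
  by rewrite mulr_ge0 // subr_ge0; case/andP: (floor_itv a).
have fr_lt a : (Num.truncn (K.+1%:R * fr a) < K.+1)%N.
  rewrite truncn_lt_nat // -[ltRHS]mulr1 ltr_pM2l // /fr ltrBlDr addrC.
  by case/andP: (floor_itv a); rewrite intrD.
pose cell t : {ffun 'I_N -> 'I_K.+1} :=
  [ffun k => inord (Num.truncn (K.+1%:R * fr (dual_form (dec t) k 0)))].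
have /injectivePn[t [u tu Ecell]] : ~~ injectiveb cell.
  apply/injectiveP => /leq_card; rewrite !card_ffun !card_ord leqNgt.
  by rewrite KT.
exists (dec t - dec u); split.
- apply: contraNneq tu => /matrixP E; apply/eqP/ffunP => k; apply: val_inj.
  by have := E k 0; rewrite !mxE => /eqP; rewrite subr_eq0 => /eqP; case.
- by move=> k; rewrite !mxE; case: (t k) (u k) => [p hp] [q hq] /=; lia.
move=> k; have /ffunP/(_ k) := Ecell; rewrite !ffunE => /(congr1 val).
have -> : dual_form (dec t - dec u) k 0 = dual_form (dec t) k 0 - dual_form (dec u) k 0.
  by rewrite /dual_form map_mxB mulmxBr !mxE.
move: (dual_form (dec t) k 0) (dual_form (dec u) k 0) => a c.
rewrite /= !inordK //= => E.
have /andP[a1 a2] := truncn_itv (fr_ge0 a); have /andP[c1 c2] := truncn_itv (fr_ge0 c).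
rewrite E in a1 a2; rewrite -(natr1 (Num.truncn _)) in a2 c2.
apply: le_trans (distZ_le _ (Num.floor a - Num.floor c)) _.
rewrite intrB (_ : _ - _ = fr a - fr c); last by rewrite /fr; ring.
rewrite -[leRHS]mul1r ler_pdivlMr // mulrC -{1}(gtr0_norm (ltr0Sn R K)) -normrM mulrBr.
by rewrite ler_norml; apply/andP; split; lra.
Qed.

Hypothesis hM : (0 < M)%N.

(** Sup-norm shells of ratio [2 ^ N]; at [i = 0] the second clause amounts to
    [y != 0]. *)
Definition block (i : nat) (y : 'cV[int]_M) : bool :=
  [forall k, `|y k 0%R| <= (2 ^ N) ^ i]%N &&
  [exists k, (2 ^ N) ^ i <= 2 ^ N * `|y k 0%R|]%N.

Definition best_in_blocks (w : nat -> 'cV[int]_M) : Prop :=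
  forall i, block i (w i) /\ forall y, block i y -> dual_error (w i) <= dual_error y.

Lemma best_in_blocks_exists : exists w, best_in_blocks w.
Proof.
suff /choice[w wP] : forall i, exists w, block i w /\
    forall y, block i y -> dual_error w <= dual_error y by exists w.
move=> i; apply: (@argmin_in_box _ _ ((2 ^ N) ^ i)%N).
  by move=> y /andP[/forallP yT _] k; exact: yT.
exists (const_mx ((2 ^ N) ^ i)%N%:Z); apply/andP; split.
  by apply/forallP => k; rewrite mxE.
by apply/existsP; exists (Ordinal hM); rewrite mxE /= leq_pmull // expn_gt0.
Qed.

(** The Dirichlet vector at scale [j] lies in some block [i <= j], whose best
    vector does at least as well. *)
Lemma best_in_blocks_error w j : best_in_blocks w ->
  exists2 i, (i <= j)%N & dual_error (w i) <= N%:R / (2 ^+ M) ^+ j.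
Proof.
move=> wP; have [||y [y0 yT ye]] := @dirichlet ((2 ^ N) ^ j)%N ((2 ^ M) ^ j)%N.
- by rewrite !expn_gt0.
- have -> : (((2 ^ M) ^ j) ^ N = ((2 ^ N) ^ j) ^ M)%N.
    by rewrite -!expnM; congr (_ ^ _)%N; lia.
  by rewrite ltn_exp2r // ltnS.
have ex : exists i, [forall k, `|y k 0%R| <= (2 ^ N) ^ i]%N.
  by exists j; apply/forallP.
have bi : block (ex_minn ex) y.
  case: ex_minnP => i yi imin; rewrite /block yi /=.
  case: i imin {yi} => [|i] imin.
    have /existsP[k yk] : [exists k, y k 0%R != 0].
      apply: contraR y0; rewrite negb_exists => /forallP h.
      by apply/eqP/matrixP => k l; rewrite (ord1 l) mxE; apply/eqP; have := h k; rewrite negbK.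
    apply/existsP; exists k; rewrite expn0 muln_gt0 expn_gt0 /=; lia.
  have : ~~ [forall k, `|y k 0%R| <= (2 ^ N) ^ i]%N.
    by apply/negP => /imin; rewrite ltnn.
  rewrite negb_forall => /existsP[k]; rewrite -ltnNge => yk.
  by apply/existsP; exists k; rewrite expnS leq_mul2l ltnW ?orbT.
exists (ex_minn ex); first by case: ex_minnP => i _; apply; apply/forallP.
apply: le_trans ((wP _).2 _ bi) _.
apply: le_trans (_ : \sum_(k < N) (2 ^+ M) ^- j <= _).
  by apply: ler_sum => k _; apply: le_trans (ye k) _; rewrite !natrX.
by rewrite sumr_const card_ord -[leLHS]mulr_natl.
Qed.

End Dirichlet.

(** * Transference and conclusion *)

Lemma dotv_mulmx (R : realType) (M N : nat) (A : 'M[R]_(M, N)) (u : 'cV[R]_M)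
    (v : 'cV[R]_N) : dotv u (A *m v) = dotv (A^T *m u) v.
Proof.
have dotE k (a c : 'cV[R]_k) : dotv a c = (a^T *m c) 0 0.
  by rewrite mxE; apply: eq_bigr => i _; rewrite mxE.
by rewrite !dotE trmx_mul trmxK mulmxA.
Qed.

Lemma dotv_intr (R : realType) (d : nat) (u v : 'cV[int]_d) :
  exists p : int, dotv (map_mx intr u : 'cV[R]_d) (map_mx intr v) = p%:~R.
Proof.
exists (\sum_k u k 0 * v k 0); rewrite rmorph_sum /=.
by apply: eq_bigr => k _; rewrite !mxE intrM.
Qed.

Lemma enorm_intr_ge1 (R : realType) (d : nat) (q : 'cV[int]_d) : q != 0 ->
  1 <= enorm (map_mx intr q : 'cV[R]_d).
Proof.
move=> q0; have /existsP[k qk] : [exists k, q k 0 != 0].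
  apply: contraR q0; rewrite negb_exists => /forallP h.
  apply/eqP/matrixP => k l; rewrite (ord1 l) mxE; apply/eqP.
  by have := h k; rewrite negbK.
apply: le_trans (ler_entry_enorm _ k); rewrite mxE -intr_norm ler1z.
by move: qk; lia.
Qed.

Section Transference.
Variables (R : realType) (M N : nat) (hM : (0 < M)%N) (hN : (0 < N)%N).
Variables (A : 'M[R]_(M, N)) (w : nat -> 'cV[int]_M).
Hypothesis wP : best_in_blocks A w.

Lemma block_entry i k : `|map_mx intr (w i) k 0 : R| <= (2 ^+ N) ^+ i.
Proof.
have [/andP[/forallP/(_ k) h _] _] := wP i.
by rewrite mxE -intr_norm -abszE pmulrn -!natrX ler_nat.
Qed.

(** [y . (A q) = (A^T y) . q], and rounding [A^T y] costs at most
    [dual_error A y] times the size of [q]. *)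
Lemma dual_pairing (q : 'cV[int]_N) i : exists p : int,
  `|dotv (map_mx intr (w i)) (A *m map_mx intr q) - p%:~R|
    <= dual_error A (w i) * enorm (map_mx intr q : 'cV[R]_N).
Proof.
pose f := dual_form A (w i); pose n k := Num.floor (f k 0 + 2^-1).
exists (\sum_k n k * q k 0).
rewrite dotv_mulmx rmorph_sum /= /dotv -sumrB /dual_error mulr_suml.
apply: le_trans (ler_norm_sum _ _ _) _; apply: ler_sum => k _.
rewrite intrM [map_mx _ _ _ _]mxE -mulrBl normrM ler_wpM2l ?normr_ge0 //.
by have := ler_entry_enorm (map_mx intr q : 'cV[R]_N) k; rewrite mxE.
Qed.

Lemma transference (x : 'cV[R]_M) (delta : R) : 0 < delta ->
  (forall i (p : int), delta <= `|dotv (map_mx intr (w i)) x - p%:~R|) ->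
  Bad A x.
Proof.
move=> d0 xP; have M0 : 0 < M%:R :> R by rewrite ltr0n.
pose C1 : R := 2 * N%:R / delta + 1.
have C1_ge1 : 1 <= C1 by rewrite /C1 lerDr divr_ge0 ?mulr_ge0 // ltW.
pose C2 := (2 ^+ M * C1) `^ (N%:R / M%:R).
have C2_gt0 : 0 < C2.
  by rewrite powR_gt0 // mulr_gt0 ?exprn_gt0 // (lt_le_trans ltr01).
pose c := delta / (2 * M%:R * C2).
have c0 : 0 < c by rewrite divr_gt0 // !mulr_gt0.
have main (q : 'cV[int]_N) (p : 'cV[int]_M) : q != 0 ->
    c <= enorm (map_mx intr q : 'cV[R]_N) `^ (N%:R / M%:R)
         * enorm (A *m map_mx intr q - x - map_mx intr p).
  move=> q0; have q1 := @enorm_intr_ge1 R _ _ q0.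
  set Q := enorm (map_mx intr q) in q1 *; set e := _ - x - _.
  have Q0 : 0 < Q by apply: lt_le_trans q1.
  (* The least scale j at which the dual error times Q is at most delta / 2. *)
  have ex : exists j, C1 * Q <= (2 ^+ M) ^+ j.
    have [|j hj] := @expr_unbounded R (2 ^+ M) _ (C1 * Q); last by exists j; rewrite ltW.
    by rewrite exprn_egt1 ?ltr1n // -lt0n.
  pose j := ex_minn ex.
  have j_lo : C1 * Q <= (2 ^+ M) ^+ j by rewrite /j; case: ex_minnP.
  have j_up : (2 ^+ M) ^+ j <= 2 ^+ M * (C1 * Q).
    rewrite /j; case: ex_minnP => [[|i]] _ imin.
      rewrite expr0; apply: le_trans (_ : 1 * (1 * 1) <= _); first by rewrite !mul1r.
      apply: ler_pM; rewrite ?mul1r //; first by rewrite exprn_ege1 // ler1n.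
      by rewrite -[1]mul1r; apply: ler_pM.
    rewrite exprS ler_pM2l ?exprn_gt0 // ltW // ltNge; apply/negP => /imin.
    by rewrite ltnn.
  have Tj : (2 ^+ N) ^+ j <= C2 * Q `^ (N%:R / M%:R).
    have B0 : 0 <= 2 ^+ M * C1 by rewrite mulr_ge0 ?exprn_ge0 // (le_trans ler01).
    rewrite -powRM ?(ltW Q0) //.
    have -> : (2 ^+ N) ^+ j = ((2 ^+ M) ^+ j) `^ (N%:R / M%:R) :> R.
      rewrite -!exprM mulnC exprM mulnC (exprM _ j) -[X in _ = X `^ _]powR_mulrn ?exprn_ge0 //.
      by rewrite -powRrM mulrC divfK ?gt_eqF // powR_mulrn ?exprn_ge0.
    rewrite -mulrA; apply: ge0_ler_powR; rewrite ?nnegrE ?divr_ge0 ?exprn_ge0 //.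
    by rewrite mulrA mulr_ge0 // ltW.
  have [i ij err] := best_in_blocks_error hM j wP.
  have [p1 p1P] := dual_pairing q i.
  have [p2 p2E] := dotv_intr R (w i) p.
  have eW := ler_dotv (block_entry i) (ler_entry_enorm e).
  have xE : dotv (map_mx intr (w i)) x = dotv (map_mx intr (w i)) (A *m map_mx intr q)
                 - p2%:~R - dotv (map_mx intr (w i)) e.
    by rewrite -p2E -!dotvBr; congr dotv; rewrite /e [_ - x - _]addrAC subKr.
  have := xP i (p1 - p2); rewrite xE intrB => dx.
  have errQ : dual_error A (w i) * Q <= delta / 2.
    apply: le_trans (_ : N%:R / (2 ^+ M) ^+ j * Q <= _).
      by rewrite ler_pM2r.
    rewrite mulrAC ler_pdivrMr ?exprn_gt0 // mulrC.
    apply: le_trans (_ : delta / 2 * (C1 * Q) <= _); last by rewrite ler_pM2l ?divr_gt0.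
    rewrite mulrA mulrC ler_pM2r // /C1.
    have -> : delta / 2 * (2 * N%:R / delta + 1) = N%:R + delta / 2.
      by field; rewrite gt_eqF.
    by rewrite lerDl divr_ge0 // ltW.
  have Ti : (2 ^+ N) ^+ i <= (2 ^+ N) ^+ j :> R.
    by apply: ler_weXn2l => //; rewrite exprn_ege1 // ler1n.
  have bound : delta / 2 <= M%:R * ((C2 * Q `^ (N%:R / M%:R)) * enorm e).
    apply: le_trans (_ : M%:R * ((2 ^+ N) ^+ i * enorm e) <= _); last first.
      by rewrite ler_pM2l // ler_wpM2r ?enorm_ge0 // (le_trans Ti).
    set E := dotv _ e in eW dx; set F := dotv _ (A *m _) in p1P dx.
    have split_sum : delta <= delta / 2 + M%:R * ((2 ^+ N) ^+ i * enorm e).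
      apply: le_trans dx _.
      have -> : F - p2%:~R - E - (p1%:~R - p2%:~R) = F - p1%:~R - E by ring.
      by apply: le_trans (ler_normB _ _) (lerD (le_trans p1P errQ) eW).
    by move: split_sum; rewrite {1}(splitr delta) lerD2l.
  rewrite /c ler_pdivrMr ?mulr_gt0 //; move: bound; rewrite ler_pdivrMr //.
  by move/le_trans; apply; rewrite le_eqVlt; apply/orP; left; apply/eqP; ring.
apply: lt_le_trans c0 _; apply: lb_le_inf.
  exists (enorm (map_mx intr (const_mx 1 : 'cV[int]_N) : 'cV[R]_N) `^ (N%:R / M%:R)
    * dist_to (A *m map_mx intr (const_mx 1 : 'cV[int]_N) - x) (@Zlattice R M)).
  exists (const_mx 1) => //=.
  by apply/eqP => /matrixP/(_ (Ordinal hN) 0); rewrite !mxE.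
move=> _ [q q0 <-]; have q1 := @enorm_intr_ge1 R _ _ q0.
have Q0 : 0 < enorm (map_mx intr q : 'cV[R]_N) `^ (N%:R / M%:R).
  by rewrite powR_gt0 // (lt_le_trans ltr01).
rewrite mulrC -ler_pdivrMr //; apply: lb_le_inf.
  exists (enorm (A *m map_mx intr q - x - map_mx intr (0 : 'cV[int]_M))).
  by exists (map_mx intr 0) => //; exists 0.
move=> _ [_ [p _ <-] <-]; rewrite ler_pdivrMr // mulrC; exact: main.
Qed.

End Transference.

Lemma winning_mono (R : realType) (d : nat) (beta : R) (S S' : set 'cV[R]_d) :
  S `<=` S' -> hyperplane_absolute_winning_at beta S ->
  hyperplane_absolute_winning_at beta S'.
Proof.
move=> SS [sigma [leg win]]; exists sigma; split=> // B /win[x [Sx Bx]].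
by exists x; split=> //; exact: SS.
Qed.

Theorem theorem1p1 (R : realType) (M N : nat) (hM : (1 <= M)%N) (hN : (1 <= N)%N)
    (A : 'M[R]_(M, N)) :
  HAW (Bad A).
Proof.
have [w wP] := best_in_blocks_exists A hM.
exists 3^-1; split=> [||beta beta0 beta3]; rewrite ?invr_gt0 //.
apply: (@winning_mono _ _ _ [set x | exists2 delta, 0 < delta &
    forall i (p : int), delta <= `|dotv (map_mx intr (w i)) x - p%:~R|]).
  by move=> x [delta d0 xP]; exact: (transference hM hN wP d0 xP).
apply: (@lacunary_absolute_winning _ _ hM (2 ^+ N)) => //.
- by rewrite exprn_egt1 ?ltr1n // -lt0n.
- lra.
- by move=> i k; exact: block_entry.
move=> i; have [/andP[_ /existsP[k h]] _] := wP i; exists k.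
by rewrite mxE -intr_norm -abszE pmulrn -!natrX -natrM ler_nat.
Qed.
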